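(* Let $G$ be a finite abelian group and let $c:G\to\mathbb{C}$ satisfy $c(g)=\overline{c(g^{-1})}$ for all $g\in G$. Let $\lambda=\max\{|\widehat{c}(\chi)|:\chi\in\widehat{G},\chi\neq\chi_0\}$. Then $\lambda\ge\sqrt{|G|\operatorname{Var}_{g\sim G}|c(g)|}$. In particular, if $c$ is real-valued, then $\lambda\ge\sqrt{|G|\operatorname{Var}_{g\sim G}c(g)}$.
   Context: $\widehat{G}$ is the group of characters (homomorphisms $G\to\mathbb{C}^*$) of $G$, $\chi_0$ the trivial character, and $\widehat{c}(\chi)=\sum_{g\in G}c(g)\overline{\chi(g)}$. $\operatorname{Var}_{g\sim G}$ denotes the variance with $g$ uniformly distributed on $G$, i.e. $\operatorname{Var}_{g\sim G}X(g)=\frac{1}{|G|}\sum_g X(g)^2-\big(\frac{1}{|G|}\sum_g X(g)\big)^2$ for real-valued $X$. *)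

(* Defs.v *)
From HB Require Import structures.
From mathcomp Require Export all_boot all_order all_algebra all_fingroup.
From mathcomp Require Import cyclic.
From mathcomp Require Export finmap.
From mathcomp Require Export all_classical all_reals.
From mathcomp Require Export complex.

Set Implicit Arguments.
Unset Strict Implicit.
Unset Printing Implicit Defensive.

Import Order.TTheory GRing.Theory Num.Theory.

Local Open Scope classical_set_scope.
Local Open Scope ring_scope.
Local Open Scope complex_scope.

Section FourierFiniteGroup.
Variables (R : realType) (gT : finGroupType).

Definition cmod (z : R[i]) : R := ComplexField.Normc.normc z.

(* Homomorphisms to C^* are represented by their underlying C-valued
   functions. *)
Definition dual_group : set {ffun gT -> R[i]} :=
  [set chi | (forall g, chi g != 0) /\
             (forall g h, chi (g * h)%g = chi g * chi h)].

Definition trivial_char : {ffun gT -> R[i]} := [ffun=> 1].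

Definition nontrivial_chars : set {ffun gT -> R[i]} :=
  [set chi | dual_group chi /\ chi <> trivial_char].

Definition fourier (c : gT -> R[i]) (chi : {ffun gT -> R[i]}) : R[i] :=
  \sum_(g : gT) c g * (chi g)^*.

(* fset_set enumerates a finite set (and is empty on an infinite one);
   finite_nontrivial_chars below shows that the set is finite, and max_fourierP
   that max_fourier c is the maximum whenever there is a nontrivial character.
   For the trivial group the maximum is over the empty set, and is 0 here. *)
Definition max_fourier (c : gT -> R[i]) : R :=
  \big[Num.max/0]_(chi <- fset_set nontrivial_chars)
    cmod (fourier c chi).

Definition variance_unif (X : gT -> R) : R :=
  #|gT|%:R^-1 * (\sum_(g : gT) X g ^+ 2)
  - (#|gT|%:R^-1 * \sum_(g : gT) X g) ^+ 2.

Lemma cmodE (z : R[i]) : (cmod z)%:C = `|z|.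
Proof. by []. Qed.

Lemma cmod_ge0 (z : R[i]) : 0 <= cmod z.
Proof. by case: z => a b; exact: sqrtr_ge0. Qed.

Lemma dual_group1 chi : dual_group chi -> chi 1%g = 1.
Proof.
move=> [chi0 chiM]; apply: (mulfI (chi0 1%g)).
by rewrite -chiM mulg1 mulr1.
Qed.

Lemma dual_groupX chi g n : dual_group chi -> chi (g ^+ n)%g = chi g ^+ n.
Proof.
move=> chiP; elim: n => [|n IHn]; first by rewrite expg0 expr0 dual_group1.
by rewrite expgS exprS chiP.2 IHn.
Qed.

Lemma finite_dual_group : finite_set dual_group.
Proof.
pose p : {poly R[i]} := 'X^#|gT| - 1.
have [rs prs] := closed_field_poly_normal p.
have p_mon : p \is monic by apply: monicXnsubC; rewrite -cardsT cardG_gt0.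
have root_chi chi g : dual_group chi -> chi g \in rs.
  move=> chiP; rewrite -root_prod_XsubC.
  move: prs; rewrite (monicP p_mon) scale1r => <-.
  rewrite rootE !hornerE ?hornerXn -dual_groupX //.
  by rewrite -cardsT expg_cardG ?inE ?dual_group1 ?subrr.
pose F (f : {ffun gT -> seq_sub rs}) : {ffun gT -> R[i]} :=
  [ffun g => ssval (f g)].
apply: (@sub_finite_set _ _ (F @` setT)); last first.
  by apply: finite_image; exact: finite_finset.
move=> chi chiP; exists [ffun g => SeqSub (root_chi chi g chiP)] => //.
by apply/ffunP => g; rewrite !ffunE.
Qed.

Lemma finite_nontrivial_chars : finite_set nontrivial_chars.
Proof. by apply: sub_finite_set finite_dual_group => chi []. Qed.

Lemma max_fourierP c (ntG : nontrivial_chars !=set0) :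
  (exists2 chi, nontrivial_chars chi & max_fourier c = cmod (fourier c chi)) /\
  (forall chi, nontrivial_chars chi -> cmod (fourier c chi) <= max_fourier c).
Proof.
have mem_nt chi :
    (chi \in fset_set nontrivial_chars) = (chi \in nontrivial_chars).
  exact: in_fset_set finite_nontrivial_chars chi.
have max_ge chi : nontrivial_chars chi -> cmod (fourier c chi) <= max_fourier c.
  move=> ntchi; rewrite /max_fourier.
  apply: (le_bigmax_seq 0 chi xpredT (fun x => cmod (fourier c x))) => //.
  by rewrite mem_nt inE.
split=> //; case: ntG => chi0 nt0.
suff [//|max0] : (exists2 chi, nontrivial_chars chi &
    max_fourier c = cmod (fourier c chi)) \/ max_fourier c = 0.
  exists chi0 => //; apply/eqP.
  by rewrite eq_le max_ge // max0 cmod_ge0.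
rewrite /max_fourier big_seq.
elim/big_ind: _ => [|x y IHx IHy|chi]; first by right.
  by case: (leP x y).
by rewrite mem_nt inE => ntchi; left; exists chi.
Qed.

End FourierFiniteGroup.

(* Main.v *)
(* By Parseval, [sum_chi |fourier c chi|^2 = |G| * sum_g |c g|^2].  The trivial
   character contributes [|sum_g c g|^2], which is at most [(sum_g |c g|)^2], and
   each of the [|G| - 1] other ones at most [lambda^2]; rearranging bounds the
   variance.  The characters themselves come from the representation theory of
   [G] over the algebraically closed field [R[i]], where every irreducible
   representation of an abelian group has degree 1. *)

Require Import Defs.
From mathcomp Require Import cyclic center pgroup mxrepresentation.

Import Order.TTheory GRing.Theory Num.Theory.
Local Open Scope ring_scope.
Local Open Scope complex_scope.

(** An irreducible representation of an abelian group is scalar, hence determined up to similarity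
    by its mode, and similar irreducibles have the same index. *)
Lemma irr_mode_inj (F : fieldType) (gT : finGroupType) (G : {group gT})
    (sG : irrType F G) : ([pchar F]^').-group%g G -> group_splitting_field F G ->
  abelian G -> forall i j : sG, {in G, irr_mode i =1 irr_mode j} -> i = j.
Proof.
move=> F'G splitG abG i j eq_ij.
have scal (k : sG) x : x \in G -> irr_repr k x = (irr_mode k x)%:M.
  by move=> Gx; apply: irr_center_scalar => //; rewrite (center_idP abG).
rewrite -(irr_reprK_pchar F'G i) -(irr_reprK_pchar F'G j).
(* Generalizing the representations lets both dependent degrees be rewritten to 1, so that the
   identity matrix can intertwine them. *)
move: (scal i) (scal j); move: (irr_repr i) (irr_repr j).
rewrite !(irr_degree_abelian splitG abG) => ri rj ri_scal rj_scal.
apply: irr_comp_rsim_pchar => //.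
exists 1%:M; rewrite ?row_free_unit ?unitmx1 // => x Gx.
by rewrite mulmx1 mul1mx ri_scal // rj_scal // eq_ij.
Qed.

Section Characters.
Variables (R : realType) (gT : finGroupType).
Implicit Types (chi psi : {ffun gT -> R[i]}) (c : gT -> R[i]).

Lemma card_gT_gt0 : (0 < #|gT|)%N.
Proof. by rewrite -cardsT cardG_gt0. Qed.

(** An abelian group has as many irreducibles as elements, since its classes are singletons.
    Indexing by ['I_#|gT|] makes the character table square. *)
Lemma enum_dual_group (abelG : abelian [set: gT]%SET) :
  exists2 chi : 'I_#|gT| -> {ffun gT -> R[i]},
    injective chi /\ (forall i, dual_group (chi i)) &
    exists i0, chi i0 = trivial_char R gT.
Proof.
pose G := [set: gT]%G.
pose sG : irrType R[i] G := DecSocleType (regular_repr R[i] G).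
have splitG : group_splitting_field R[i] G.
  exact: group_closure_closed_field.
have F'G : ([pchar R[i]]^').-group%g G.
  by rewrite /pgroup (eq_pnat _ (eq_negn (@pchar_num R[i]))); apply/pnatP.
(* Modes are nonzero and multiplicative on the center, which is here the whole group. *)
have ZG g : g \in 'Z(G)%g by rewrite (center_idP abelG) inE.
have cardG : #|gT| = #|sG|.
  rewrite (card_irr_pchar sG F'G splitG).
  by move: abelG; rewrite card_classes_abelian cardsT => /eqP.
pose chi i : {ffun gT -> R[i]} :=
  [ffun g => irr_mode (enum_val (cast_ord cardG i) : sG) g].
exists chi; first split.
- move=> i j /ffunP eq_ij; apply: (@cast_ord_inj _ _ cardG).
  apply: enum_val_inj; apply: (@irr_mode_inj _ _ _ sG F'G splitG abelG) => g _.
  by have := eq_ij g; rewrite !ffunE.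
- move=> i; split=> [g|g h]; rewrite !ffunE.
    exact: (irr_mode_neq0 splitG).
  exact: (irr_modeM splitG).
- exists (cast_ord (esym cardG) (enum_rank [1 sG]%irr)).
  by apply/ffunP => g; rewrite !ffunE cast_ordKV enum_rankK irr1_mode ?inE.
Qed.

(** The values are roots of unity of order dividing [#|gT|]. *)
Lemma dual_group_norm chi g : dual_group chi -> `|chi g| = 1.
Proof.
move=> chiP; apply/eqP; rewrite -(@pexpr_eq1 _ _ #|gT|) ?card_gT_gt0 //.
rewrite -normrX -dual_groupX // -cardsT expg_cardG ?inE //.
by rewrite dual_group1 // normr1.
Qed.

Lemma dual_group_conj chi g : dual_group chi -> chi g * (chi g)^* = 1.
Proof.
by move=> chiP; rewrite -(normCK (chi g)) dual_group_norm // expr1n.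
Qed.

(** If [chi] and [psi] differ at [h], translating the sum by [h] multiplies it by [u != 1], so it
    vanishes. *)
Lemma dual_group_orthogonal chi psi : dual_group chi -> dual_group psi ->
  \sum_g chi g * (psi g)^* = (#|gT| * (chi == psi))%:R.
Proof.
move=> chiP psiP; have [<-|neq] := eqVneq chi psi.
  rewrite muln1 (eq_bigr (fun=> 1)) => [|g _]; last exact: dual_group_conj.
  by rewrite sumr_const.
rewrite muln0; have [h neq_h] : exists h, chi h != psi h.
  by apply/existsP; apply: contraNT neq; rewrite negb_exists => /forallP eqh;
    apply/eqP/ffunP => h; apply/eqP; have := eqh h; rewrite negbK.
set S := \sum_g _; pose u := chi h * (psi h)^*.
have uS : u * S = S.
  rewrite [RHS](reindex_inj (mulgI h)) mulr_sumr; apply: eq_bigr => g _ /=.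
  by rewrite chiP.2 psiP.2 rmorphM mulrACA.
have : (u - 1) * S = 0 by rewrite mulrBl uS mul1r subrr.
move/eqP; rewrite mulf_eq0 subr_eq0 => /orP[|/eqP //] /eqP u1.
case/eqP: neq_h; rewrite -[LHS]mulr1 -(dual_group_conj psi h psiP).
by rewrite mulrCA -/u u1 mulr1.
Qed.

(** Row orthogonality says [A *m B = 1%:M]; as the matrices are square, [B *m A = 1%:M] too, and its
    entries are the column relations. *)
Lemma dual_group_column_orthogonal (chi : 'I_#|gT| -> {ffun gT -> R[i]}) g h :
  injective chi -> (forall i, dual_group (chi i)) ->
  \sum_i (chi i g)^* * chi i h = (#|gT| * (g == h))%:R.
Proof.
move=> chi_inj chiP; pose n : R[i] := #|gT|%:R.
have n0 : n != 0 by rewrite pnatr_eq0 -lt0n card_gT_gt0.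
pose A : 'M[R[i]]_#|gT| := \matrix_(i, j) chi i (enum_val j).
pose B : 'M[R[i]]_#|gT| := \matrix_(j, i) (n^-1 * (chi i (enum_val j))^*).
have AB1 : A *m B = 1%:M.
  apply/matrixP => i j; rewrite !mxE.
  under eq_bigr do rewrite !mxE mulrCA.
  rewrite -mulr_sumr -(big_enum_val (fun g => chi i g * (chi j g)^*)) /=.
  rewrite dual_group_orthogonal // (inj_eq chi_inj) natrM -/n mulrA mulVf //.
  by rewrite mul1r.
have := congr1 (fun M : 'M_#|gT| => M (enum_rank g) (enum_rank h))
  (mulmx1C AB1).
rewrite !mxE; under eq_bigr do rewrite !mxE !enum_rankK -mulrA.
rewrite -mulr_sumr (inj_eq enum_rank_inj) => /(congr1 ( *%R n)).
by rewrite mulrA mulfV // mul1r natrM.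
Qed.

Lemma cmod_sqr (z : R[i]) : (cmod z ^+ 2)%:C = z * z^*.
Proof. by rewrite -(normCK z) -cmodE -rmorphXn. Qed.

(** Expanding the squares and summing over the characters first leaves only the diagonal terms, by
    column orthogonality. *)
Lemma parseval (chi : 'I_#|gT| -> {ffun gT -> R[i]}) c :
  injective chi -> (forall i, dual_group (chi i)) ->
  \sum_i cmod (fourier c (chi i)) ^+ 2 = #|gT|%:R * \sum_g cmod (c g) ^+ 2.
Proof.
move=> chi_inj chiP; apply: (@complexI R).
rewrite rmorph_sum rmorphM rmorph_sum rmorph_nat /=.
under eq_bigr do rewrite cmod_sqr.
under [in RHS]eq_bigr do rewrite cmod_sqr.
transitivity (\sum_g \sum_h c g * (c h)^* * \sum_i (chi i g)^* * chi i h).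
  under [in RHS]eq_bigr do under eq_bigr do rewrite mulr_sumr.
  under [in RHS]eq_bigr do rewrite exchange_big.
  rewrite [RHS]exchange_big; apply: eq_bigr => i _.
  rewrite /fourier rmorph_sum big_distrlr; apply: eq_bigr => g _ /=.
  apply: eq_bigr => h _; rewrite rmorphM /= mulrACA.
  by congr (_ * (_ * _)); exact: conjcK.
rewrite mulr_sumr; apply: eq_bigr => g _.
under eq_bigr do rewrite dual_group_column_orthogonal //.
rewrite (bigD1 g) //= eqxx muln1 big1 => [|h neq_hg].
  by rewrite addr0 mulrC.
by rewrite eq_sym (negPf neq_hg) muln0 mulr0.
Qed.

Lemma max_fourier_ge0 c : 0 <= max_fourier c.
Proof.
rewrite /max_fourier; elim/big_ind: _ => // [x y x0 _|chi _].
  by rewrite le_max x0.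
exact: cmod_ge0.
Qed.

(** Keeping [X] abstract serves both the modulus of [c] and, for real [c], its real part. *)
Lemma sqrt_variance_le c (X : gT -> R) (abelG : abelian [set: gT]%SET) :
    (forall g, X g ^+ 2 = cmod (c g) ^+ 2) ->
    cmod (\sum_g c g) ^+ 2 <= (\sum_g X g) ^+ 2 ->
  Num.sqrt (#|gT|%:R * variance_unif X) <= max_fourier c.
Proof.
move=> X_sqr sum_le.
have [chi [chi_inj chiP] [i0 chi_i0]] := enum_dual_group abelG.
pose n : R := #|gT|%:R; have n_gt0 : 0 < n by rewrite ltr0n card_gT_gt0.
have lambda_ge i : i != i0 -> cmod (fourier c (chi i)) <= max_fourier c.
  move=> neq_i; have nt_i : nontrivial_chars (chi i).
    by split=> //; rewrite -chi_i0 => /chi_inj/eqP; apply/negP.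
  (* The character at hand witnesses nonemptiness, so the trivial group needs no separate case. *)
  by apply: (max_fourierP c _).2 => //; exists (chi i).
have : n * \sum_g cmod (c g) ^+ 2 <=
    (\sum_g X g) ^+ 2 + n * max_fourier c ^+ 2.
  rewrite -(parseval chi c chi_inj chiP) (bigD1 i0) //= lerD //.
    rewrite chi_i0 /fourier (eq_bigr c) // => g _.
    by rewrite ffunE rmorph1 mulr1.
  apply: (@le_trans _ _ (\sum_(i | i != i0) max_fourier c ^+ 2)).
    by apply: ler_sum => i /lambda_ge ?; rewrite lerXn2r ?nnegrE ?cmod_ge0
      ?max_fourier_ge0.
  (* The number of indices other than [i0] is bounded by [#|gT|], which is the factor that cancels
     below. *)
  rewrite sumr_const -mulr_natl ler_wpM2r ?sqr_ge0 // ler_nat.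
  by rewrite -[leqRHS]card_ord max_card.
under eq_bigr do rewrite -X_sqr.
move=> main; rewrite -[leRHS](ger0_norm (max_fourier_ge0 c)) -sqrtr_sqr.
apply: ler_wsqrtr; rewrite -(ler_pM2l n_gt0) /variance_unif -/n.
rewrite exprMn exprVn mulrBr mulVKf ?gt_eqF // mulrBr expr2 invfM -mulrA.
by rewrite mulVKf ?mulVKf ?gt_eqF // lerBlDl.
Qed.

End Characters.

Theorem theorem5p1 (R : realType) (gT : finGroupType) (c : gT -> R[i])
  (abelG : abelian [set: gT]%SET)
  (cV : forall g : gT, c g = (c (g^-1)%g)^*) :
  Num.sqrt (#|gT|%:R * variance_unif (fun g => cmod (c g))) <= max_fourier c
  /\ ((forall g : gT, c g \is Num.real) ->
      Num.sqrt (#|gT|%:R * variance_unif (fun g => complex.Re (c g)))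
        <= max_fourier c).
Proof.
have cmod_real (x : R) : cmod x%:C ^+ 2 = x ^+ 2.
  by rewrite /cmod /= expr0n addr0 sqr_sqrtr ?addr_ge0 ?sqr_ge0.
split=> [|c_real].
  apply: sqrt_variance_le => //.
  (* For [X] the modulus, the condition on sums is the triangle inequality; for real [c] it is an
     equality. *)
  rewrite lerXn2r ?nnegrE ?cmod_ge0 ?sumr_ge0 // => [g _|].
    exact: cmod_ge0.
  rewrite -lecR cmodE rmorph_sum /=.
  by under [leRHS]eq_bigr do rewrite cmodE; exact: ler_norm_sum.
have cE g : c g = (complex.Re (c g))%:C by rewrite RRe_real.
apply: sqrt_variance_le => // [g|]; first by rewrite [in RHS]cE cmod_real.
by rewrite (eq_bigr _ (fun g _ => cE g)) -rmorph_sum cmod_real.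
Qed.
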